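(* Let $n \geq 3$ and let $(\mu, \Sigma)$ satisfy the normalization below. Then there exists an infinite set $\mathcal{S}$ of pairs $(\mu', \Sigma')$, each satisfying the same normalization, such that for all $i, j \in [n]$ and all $(\mu', \Sigma') \in \mathcal{S}$, $$\Pr_{X \sim \mathcal{N}(\mu, \Sigma)}\{X_i \geq X_j\} = \Pr_{X \sim \mathcal{N}(\mu', \Sigma')}\{X_i \geq X_j\}.$$
   Context: Correlated probit model: utilities $X \sim \mathcal{N}(\mu, \Sigma)$ with $\mu \in \mathbb{R}^n$ and $\Sigma \in \mathbb{R}^{n\times n}$ symmetric positive semidefinite. Normalization: $\langle \mu, \mathbf{1}\rangle = 0$, $\Sigma \mathbf{1} = 0$, $\operatorname{Tr}(\Sigma) = n$, and $\operatorname{rank}(\Sigma) = n-1$, where $\mathbf{1}$ is the all-ones vector. This normalization does not change the distribution of choices. *)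

(* Defs.v *)
From HB Require Import structures.
From mathcomp Require Import all_boot all_order all_algebra.
From mathcomp Require Import all_classical all_reals all_analysis.
Set Implicit Arguments. Unset Strict Implicit. Unset Printing Implicit Defensive.
Import Order.TTheory GRing.Theory Num.Theory.
Local Open Scope classical_set_scope.
Local Open Scope ring_scope.

Definition gauss1 {R : realType} (m v : R) : set R -> \bar R :=
  if v == 0 then dirac m else normal_prob m (Num.sqrt v).

(* Law of the linear functional <a, X> for X ~ N(mu, S): it is N(<a,mu>, a^T S a)
   (this is the standard linear-functional definition of the multivariate normal). *)
Definition mvn_linfun_law {R : realType} (n : nat) (mu : 'cV[R]_n) (S : 'M[R]_n)
  (a : 'cV[R]_n) : set R -> \bar R :=
  gauss1 ((a^T *m mu) 0 0) ((a^T *m S *m a) 0 0).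

Definition diff_vec {R : realType} (n : nat) (i j : 'I_n) : 'cV[R]_n :=
  \col_k ((k == i)%:R - (k == j)%:R).

(* Pr_{X ~ N(mu,S)} { X_i >= X_j } = Pr { <e_i - e_j, X> >= 0 } *)
Definition prob_ge {R : realType} (n : nat) (mu : 'cV[R]_n) (S : 'M[R]_n)
  (i j : 'I_n) : \bar R :=
  mvn_linfun_law mu S (diff_vec i j) [set x : R | 0 <= x].

Definition normalized {R : realType} (n : nat) (mu : 'cV[R]_n) (S : 'M[R]_n) : Prop :=
  S^T = S /\
  (forall x : 'cV[R]_n, 0 <= (x^T *m S *m x) 0 0) /\
  \sum_(i < n) mu i 0 = 0 /\
  S *m (const_mx 1 : 'cV[R]_n) = 0 /\
  \tr S = n%:R /\
  \rank S = n.-1.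

(* Main.v *)
Require Import Defs.
From HB Require Import structures.
From mathcomp Require Import all_boot all_order all_algebra.
From mathcomp Require Import all_classical all_reals all_analysis.
From mathcomp Require Import ring lra.

Set Implicit Arguments.
Unset Strict Implicit.
Unset Printing Implicit Defensive.

Import Order.TTheory GRing.Theory Num.Theory numFieldNormedType.Exports.
Local Open Scope classical_set_scope.
Local Open Scope ring_scope.

(** Write [V k l] for the variance of [X_k - X_l]. Only the ratios
    [(mu k - mu l) / sqrt (V k l)] matter, and [(mu, S)] is determined by [mu]
    and [V] up to centering, while [S] being positive definite on the hyperplane
    orthogonal to the all-ones vector is an open condition on [V]. If two
    coordinates of [mu] agree, the corresponding [V k l] can be perturbed without
    changing any ratio; otherwise the largest coordinate of [mu] can be moved,
    with [V] adjusted so as to keep all the ratios. Centering the perturbed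
    matrix and rescaling it to trace [n] restores the normalization. *)

(** * Scale invariance of Gaussian half-line probabilities *)

Lemma normal_pdf_scale (R : realType) (m s r x : R) : s != 0 -> 0 < r ->
  normal_pdf (r * m) (r * s) (r * x) * r = normal_pdf m s x.
Proof.
move=> s0 r0; have rn0 : r != 0 by rewrite gt_eqF.
rewrite !normal_pdfE ?mulf_neq0// mulrAC; congr (_ * _).
  rewrite /normal_peak (_ : (r * s) ^+ 2 * pi *+ 2 = r ^+ 2 * (s ^+ 2 * pi *+ 2)).
    by rewrite sqrtrM ?sqr_ge0// sqrtr_sqr gtr0_norm// invfM mulrAC mulVf// mul1r.
  by rewrite exprMn -mulrA mulrnAr.
rewrite /normal_fun; congr expR.
by rewrite -mulrBr !exprMn -mulrnAr -mulrN invfM mulrACA divff ?mul1r// expf_neq0.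
Qed.

(** Substituting [r * x] maps the half-line onto itself, and the Jacobian [r] is absorbed by
    [normal_pdf_scale]. *)
Lemma normal_prob_ge0_scale (R : realType) (m s r : R) : s != 0 -> 0 < r ->
  normal_prob (r * m) (r * s) [set x | 0 <= x] = normal_prob m s [set x | 0 <= x].
Proof.
move=> s0 r0.
have -> : [set x : R | 0 <= x] = `[0, +oo[%classic.
  by apply/seteqP; split=> x /=; rewrite in_itv/= andbT.
have DF : (fun x : R => r * x)^`()%classic = cst r.
  by apply/funext => x; rewrite derive1E deriveZ//= derive_id /GRing.scale/= mulr1.
have cF : continuous (fun x : R => r * x) by exact: mulrl_continuous.
have rs0 : r * s != 0 by rewrite mulf_neq0// gt_eqF.
have := @increasing_ge0_integration_by_substitutiony R (fun x => r * x)
  (normal_pdf (r * m) (r * s)) 0.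
rewrite mulr0 /normal_prob => ->.
- by apply: eq_integral => x _; rewrite DF /= -[in RHS](@normal_pdf_scale _ m s r).
- by move=> x y _ _ xy; rewrite ltr_pM2l.
- by rewrite DF => ? _; exact: cvg_cst.
- by rewrite DF; exact: is_cvg_cst.
- by rewrite DF; exact: is_cvg_cst.
- split; first by move=> x _; exact: derivableZ.
  by apply: cvg_at_right_filter; exact: cF.
- exact: gt0_cvgMry.
- by apply: continuous_subspaceT; exact: continuous_normal_pdf.
- by move=> x _; exact: normal_pdf_ge0.
Qed.

(** For [v = 0] both laws are Dirac masses, and [r * m] and [m] are nonnegative together. This case
    covers [X_i - X_i], whose variance is zero. *)
Lemma gauss1_ge0_scale (R : realType) (m v r : R) : 0 <= v -> 0 < r ->
  gauss1 (r * m) (r ^+ 2 * v) [set x | 0 <= x] = gauss1 m v [set x | 0 <= x].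
Proof.
move=> v0 r0; rewrite /gauss1 mulf_eq0 expf_eq0/= (gt_eqF r0)/=.
have [_|vn0] := eqVneq v 0.
  rewrite !diracE; congr ((nat_of_bool _)%:R%:E).
  by apply/idP/idP; rewrite !inE/= pmulr_rge0.
have s0 : Num.sqrt v != 0 by rewrite gt_eqF// sqrtr_gt0 lt_def vn0.
have -> : Num.sqrt (r ^+ 2 * v) = r * Num.sqrt v.
  by rewrite sqrtrM ?sqr_ge0// sqrtr_sqr (gtr0_norm r0).
exact: normal_prob_ge0_scale.
Qed.

(** * Quadratic forms and difference vectors *)

Definition quad_form {R : realType} {n : nat} (M : 'M[R]_n) (x : 'cV[R]_n) : R :=
  (x^T *m M *m x) 0 0.

Lemma quad_formE (R : realType) (n : nat) (M : 'M[R]_n) (x : 'cV[R]_n) :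
  quad_form M x = \sum_k \sum_l x k 0 * M k l * x l 0.
Proof.
rewrite /quad_form mxE exchange_big/=; apply: eq_bigr => l _.
by rewrite mxE mulr_suml; apply: eq_bigr => k _; rewrite mxE.
Qed.

Lemma quad_formDl (R : realType) (n : nat) (M N : 'M[R]_n) (x : 'cV[R]_n) :
  quad_form (M + N) x = quad_form M x + quad_form N x.
Proof. by rewrite /quad_form mulmxDr mulmxDl mxE. Qed.

Lemma quad_formZl (R : realType) (n : nat) a (M : 'M[R]_n) (x : 'cV[R]_n) :
  quad_form (a *: M) x = a * quad_form M x.
Proof. by rewrite /quad_form -scalemxAr -scalemxAl mxE. Qed.

Lemma quad_form_delta (R : realType) (n : nat) (M : 'M[R]_n) (k : 'I_n) :
  quad_form M (delta_mx k 0) = M k k.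
Proof. by rewrite /quad_form trmx_delta -rowE -colE !mxE. Qed.

Lemma diff_vecE (R : realType) (n : nat) (k l : 'I_n) :
  diff_vec k l = delta_mx k 0 - delta_mx l 0 :> 'cV[R]_n.
Proof. by apply/colP => i; rewrite !mxE !andbT. Qed.

Lemma diff_vec_neq0 (R : realType) (n : nat) (k l : 'I_n) : k != l ->
  diff_vec k l != 0 :> 'cV[R]_n.
Proof.
move=> kl; apply/eqP => /colP/(_ k)/eqP.
by rewrite !mxE eqxx (negbTE kl) subr0 oner_eq0.
Qed.

Lemma diff_vec_dot (R : realType) (n : nat) (k l : 'I_n) (m : 'cV[R]_n) :
  ((diff_vec k l)^T *m m) 0 0 = m k 0 - m l 0.
Proof. by rewrite diff_vecE linearB/= mulmxBl !trmx_delta -!rowE !mxE. Qed.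

Lemma sum_diff_vec (R : realType) (n : nat) (k l : 'I_n) :
  \sum_i (diff_vec k l : 'cV[R]_n) i 0 = 0.
Proof.
have := @diff_vec_dot R n k l (const_mx 1); rewrite !mxE subrr => d0.
by rewrite -[RHS]d0; apply: eq_bigr => i _; rewrite !mxE mulr1.
Qed.

Lemma quad_form_diff_vec (R : realType) (n : nat) (M : 'M[R]_n) (k l : 'I_n) :
  quad_form M (diff_vec k l) = M k k - M k l - M l k + M l l.
Proof.
rewrite /quad_form diff_vecE [(_ - _)^T]linearB/= mulmxBl !trmx_delta -!rowE.
rewrite mulmxBr.
rewrite -!colE !mxE; ring.
Qed.

Lemma prob_geE (R : realType) (n : nat) (mu : 'cV[R]_n) (S : 'M[R]_n) i j :
  prob_ge mu S i j =
  gauss1 (mu i 0 - mu j 0) (quad_form S (diff_vec i j)) [set x | 0 <= x].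
Proof. by rewrite /prob_ge /mvn_linfun_law diff_vec_dot. Qed.

(** Bound each [|x_k x_l|] by [(x_k^2 + x_l^2) / 2]; in the double sum every square then occurs with
    total weight [n]. *)
Lemma quad_form_bound (R : realType) (n : nat) (M : 'M[R]_n) (c : R) (x : 'cV[R]_n) :
  (forall k l, `|M k l| <= c) ->
  `|quad_form M x| <= c * n%:R * \sum_k x k 0 ^+ 2.
Proof.
move=> Mc; rewrite quad_formE.
have -> : c * n%:R * \sum_k x k 0 ^+ 2 =
    \sum_k \sum_l c * ((x k 0 ^+ 2 + x l 0 ^+ 2) / 2).
  under [RHS]eq_bigr do rewrite -mulr_sumr -mulr_suml big_split/= sumr_const card_ord.
  rewrite -[RHS]mulr_sumr -mulr_suml [in RHS]big_split/= sumrMnl sumr_const card_ord.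
  rewrite -mulrA; congr (_ * _).
  by rewrite -[X in X + _]mulr_natl; field.
apply: le_trans (ler_norm_sum _ _ _) _; apply: ler_sum => k _.
apply: le_trans (ler_norm_sum _ _ _) _; apply: ler_sum => l _.
rewrite mulrAC mulrC normrM; apply: ler_pM => //.
rewrite ler_norml; have := sqr_ge0 (x k 0 + x l 0); have := sqr_ge0 (x k 0 - x l 0).
by move=> h1 h2; apply/andP; split; lra.
Qed.

(** * Positive semidefinite forms and coercivity on the hyperplane *)

Definition psd {R : realType} {n : nat} (S : 'M[R]_n) : Prop :=
  S^T = S /\ forall x, 0 <= quad_form S x.

(** The polynomial [quad_form S (t *: x + y)] in [t] is nonnegative, so its discriminant is not
    positive. *)
Lemma psd_Cauchy_Schwarz (R : realType) (n : nat) (S : 'M[R]_n) (x y : 'cV[R]_n) :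
  psd S -> (x^T *m S *m y) 0 0 ^+ 2 <= quad_form S x * quad_form S y.
Proof.
move=> [Ssym S0]; set b := (_ *m _ *m y) 0 0.
have bE : (y^T *m S *m x) 0 0 = b.
  have -> : b = (x^T *m S *m y)^T 0 0 by rewrite mxE.
  by rewrite !trmx_mul trmxK Ssym mulmxA.
have key t : 0 <= quad_form S x * t ^+ 2 + 2 * b * t + quad_form S y.
  rewrite (_ : _ + _ = quad_form S (t *: x + y))//.
  rewrite /quad_form [(_ + _)^T]linearD/= [(_ *: _)^T]linearZ/= !mulmxDl !mulmxDr.
  rewrite -!scalemxAl -!scalemxAr.
  have D (B C : 'M[R]_1) : (B + C) 0 0 = B 0 0 + C 0 0 by rewrite mxE.
  have Z u (B : 'M[R]_1) : (u *: B) 0 0 = u * B 0 0 by rewrite mxE.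
  rewrite !(D, Z) bE -/b; ring.
have [a0|a0] := eqVneq (quad_form S x) 0.
  rewrite a0 mul0r; have [->|b0] := eqVneq b 0; first by rewrite expr0n.
  (* The polynomial is now affine with slope [2 * b], and at this [t] it would equal [-1]. *)
  have := key (- (quad_form S y + 1) / (2 * b)).
  rewrite a0 mul0r add0r mulrC divfK ?mulf_neq0 ?pnatr_eq0//; lra.
have ap : 0 < quad_form S x by rewrite lt_def a0 S0.
(* This [t] is the minimizer of the polynomial. *)
have := key (- b / quad_form S x); rewrite -(pmulr_rge0 _ ap).
set a := quad_form S x in a0 ap *.
rewrite [X in 0 <= X](_ : _ = a * quad_form S y - b ^+ 2); last by field.
by rewrite subr_ge0.
Qed.

Lemma mulmx_const1 (R : realType) (n : nat) (x : 'cV[R]_n) :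
  x^T *m (const_mx 1 : 'cV[R]_n) = (\sum_k x k 0)%:M.
Proof.
apply/rowP => i; rewrite !ord1 !mxE eqxx mulr1n.
by apply: eq_bigr => k _; rewrite !mxE mulr1.
Qed.

Lemma mxrank_const1 (R : realType) (n : nat) : (0 < n)%N ->
  \rank (const_mx 1 : 'cV[R]_n) = 1%N.
Proof.
case: n => // n _; apply/eqP; rewrite eqn_leq rank_leq_col lt0n mxrank_eq0.
by apply/eqP => /colP/(_ 0)/eqP; rewrite !mxE oner_eq0.
Qed.

(* The pseudo-inverse [Q] of [S] gives [x^T = x^T Q S] on the hyperplane, so
   Cauchy-Schwarz for the form [S] yields
   [|x|^4 <= (x^T Q S Q^T x) (x^T S x) <= K |x|^2 (x^T S x)]. *)
Lemma psd_coercive (R : realType) (n : nat) (S : 'M[R]_n) : (0 < n)%N ->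
  psd S -> S *m (const_mx 1 : 'cV[R]_n) = 0 -> \rank S = n.-1 ->
  exists2 d : R, 0 < d & forall x : 'cV[R]_n, \sum_k x k 0 = 0 ->
    d * \sum_k x k 0 ^+ 2 <= quad_form S x.
Proof.
move=> n0 psdS S1 rkS; set e := const_mx 1 in S1.
(* [kermx e] is the hyperplane orthogonal to the all-ones vector. It contains the row space of [S]
   and has the same dimension, so the two are equal and [pinvmx S] inverts [S] there. *)
have SK : (S <= kermx e)%MS by apply/sub_kermxP.
have KS : (kermx e <= S)%MS.
  rewrite -(geq_leqif (mxrank_leqif_sup SK)) mxrank_ker mxrank_const1//.
  by rewrite rkS subn1.
pose Q := pinvmx S; pose M := Q *m S *m Q^T.
pose C := \sum_k \sum_l `|M k l|.
have MC k l : `|M k l| <= C.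
  rewrite /C (bigD1 k)//= (bigD1 l)//= -addrA lerDl addr_ge0// sumr_ge0// => i _.
  by rewrite sumr_ge0.
have C0 : 0 <= C by apply: sumr_ge0 => k _; exact: sumr_ge0.
(* Adding 1 makes the constant invertible even if [C] vanishes. *)
have K0 : 0 < C * n%:R + 1 by rewrite ltr_wpDl// mulr_ge0.
exists (C * n%:R + 1)^-1; first by rewrite invr_gt0.
move=> x x0; set q := \sum_k _; rewrite mulrC ler_pdivrMr//.
have q0 : 0 <= q by apply: sumr_ge0 => k _; exact: sqr_ge0.
have S0 := psdS.2 x.
have [->|qn0] := eqVneq q 0; first by rewrite mulr_ge0// ltW.
have qp : 0 < q by rewrite lt_def qn0.
have xS : x^T *m Q *m S = x^T.
  apply: mulmxKpV; apply: submx_trans KS; apply/sub_kermxP.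
  by rewrite mulmx_const1 x0 raddf0.
have := @psd_Cauchy_Schwarz R n S (x^T *m Q)^T x psdS.
rewrite trmxK xS.
have -> : (x^T *m x) 0 0 = q.
  by rewrite mxE; apply: eq_bigr => k _; rewrite mxE.
have -> : quad_form S (x^T *m Q)^T = quad_form M x.
  by rewrite /quad_form /M trmxK trmx_mul trmxK !mulmxA.
have := quad_form_bound x MC; rewrite -/q => Mb qq.
have Mq : quad_form M x <= (C * n%:R + 1) * q.
  apply: le_trans (ler_norm _) (le_trans Mb _).
  by rewrite ler_wpM2r// lerDl.
rewrite -(ler_pM2l qp) -expr2; apply: le_trans qq _.
rewrite [leRHS](_ : _ = (C * n%:R + 1) * q * quad_form S x); last by ring.
exact: ler_wpM2r.
Qed.

(** * Centering and rescaling to the normalization *)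

(** For [0 < n], the orthogonal projector onto the hyperplane of vectors with zero sum. *)
Definition centering {R : realType} (n : nat) : 'M[R]_n :=
  1%:M - n%:R^-1 *: const_mx 1.

Lemma trmx_centering (R : realType) (n : nat) :
  (centering n)^T = centering n :> 'M[R]_n.
Proof. by rewrite /centering linearB/= trmx1 linearZ/= trmx_const. Qed.

Lemma centeringE (R : realType) (n : nat) (x : 'cV[R]_n) k :
  (centering n *m x) k 0 = x k 0 - n%:R^-1 * \sum_i x i 0.
Proof.
rewrite /centering mulmxBl mul1mx -scalemxAl !mxE; congr (_ - _ * _).
by apply: eq_bigr => i _; rewrite mxE mul1r.
Qed.

Lemma centering_id (R : realType) (n : nat) (x : 'cV[R]_n) :
  \sum_i x i 0 = 0 -> centering n *m x = x.
Proof. by move=> x0; apply/colP => k; rewrite centeringE x0 mulr0 subr0. Qed.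

Lemma sum_centering (R : realType) (n : nat) (x : 'cV[R]_n) : (0 < n)%N ->
  \sum_i (centering n *m x) i 0 = 0.
Proof.
move=> n0; under eq_bigr do rewrite centeringE.
rewrite sumrB sumr_const card_ord -[X in _ - X]mulr_natl mulrA divff ?mul1r ?subrr//.
by rewrite pnatr_eq0 -lt0n.
Qed.

Lemma centering_const1 (R : realType) (n : nat) : (0 < n)%N ->
  centering n *m (const_mx 1 : 'cV[R]_n) = 0.
Proof.
move=> n0; apply/colP => k; rewrite centeringE !mxE.
under eq_bigr do rewrite mxE.
by rewrite sumr_const card_ord mulVf ?subrr// pnatr_eq0 -lt0n.
Qed.

(** Centering on both sides kills the all-ones vector but keeps the form on zero-sum vectors, hence
    all variances of differences. *)
Definition center_form {R : realType} {n : nat} (A : 'M[R]_n) : 'M[R]_n :=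
  centering n *m A *m centering n.

Lemma quad_form_center (R : realType) (n : nat) (A : 'M[R]_n) (x : 'cV[R]_n) :
  quad_form (center_form A) x = quad_form A (centering n *m x).
Proof.
by rewrite /quad_form /center_form trmx_mul trmx_centering !mulmxA.
Qed.

Definition pos_on_centered {R : realType} {n : nat} (A : 'M[R]_n) : Prop :=
  forall x : 'cV[R]_n, \sum_k x k 0 = 0 -> x != 0 -> 0 < quad_form A x.

(** Each diagonal entry is the value of [A] at a centered basis vector, which is nonzero because its
    own coordinate is [1 - 1/n]. *)
Lemma center_form_trace_gt0 (R : realType) (n : nat) (A : 'M[R]_n) :
  (1 < n)%N -> pos_on_centered A -> 0 < \tr (center_form A).
Proof.
move=> n1 Apos; have n0 := ltnW n1.
rewrite /mxtrace; under eq_bigr do rewrite -quad_form_delta quad_form_center.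
have posk k : 0 < quad_form A (centering n *m delta_mx k 0).
  apply: Apos; first exact: sum_centering.
  apply/eqP => /colP/(_ k)/eqP; rewrite centeringE !mxE !eqxx/=.
  rewrite (bigD1 k)//= big1 ?addr0; last first.
    by move=> i ik; rewrite mxE (negbTE ik).
  by rewrite mxE !eqxx mulr1 subr_eq0 eq_sym invr_eq1 pnatr_eq1 gtn_eqF.
rewrite (bigD1 (Ordinal n0))//= ltr_wpDr//.
by apply: sumr_ge0 => k _; exact: ltW.
Qed.

(** The kernel is the line of constant vectors: the form vanishes at the centered part of any kernel
    vector, so positivity makes that part zero. *)
Lemma center_form_rank (R : realType) (n : nat) (A : 'M[R]_n) :
  (1 < n)%N -> pos_on_centered A -> \rank (center_form A) = n.-1.
Proof.
move=> n1 Apos; have n0 := ltnW n1.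
have A1 : center_form A *m (const_mx 1 : 'cV[R]_n) = 0.
  by rewrite /center_form -mulmxA centering_const1// mulmx0.
apply/eqP; rewrite eqn_leq -!subn1; apply/andP; split.
  rewrite -(mxrank_const1 R n0) -mxrank_ker; apply: mxrankS.
  exact/sub_kermxP.
rewrite leq_subCl -mxrank_ker.
apply: leq_trans (rank_leq_row (const_mx 1 : 'rV[R]_n)).
apply/mxrankS/rV_subP => u /sub_kermxP uA0.
have Hu : centering n *m u^T = 0.
  apply/eqP/negPn/negP => /Apos-/(_ (sum_centering _ n0)).
  by rewrite -quad_form_center /quad_form trmxK uA0 mul0mx mxE ltxx.
apply/sub_rVP; exists (n%:R^-1 * \sum_i u 0 i).
apply/rowP => k; have /colP/(_ k) := Hu; rewrite centeringE !mxE.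
under eq_bigr do rewrite mxE.
by move=> /subr0_eq ->; rewrite mulr1.
Qed.

(** Multiplying utilities by [c] multiplies means by [c] and covariances by [c ^+ 2]; this [c] makes
    the trace equal to [n]. *)
Definition rescale {R : realType} {n : nat} (m : 'cV[R]_n) (A : 'M[R]_n) :
    'cV[R]_n * 'M[R]_n :=
  let c := Num.sqrt (n%:R / \tr (center_form A)) in
  (c *: m, c ^+ 2 *: center_form A).

Lemma rescale_factor_gt0 (R : realType) (n : nat) (A : 'M[R]_n) :
  (1 < n)%N -> pos_on_centered A ->
  0 < Num.sqrt (n%:R / \tr (center_form A)).
Proof.
move=> n1 Apos; rewrite sqrtr_gt0 divr_gt0 ?ltr0n ?(ltnW n1)//.
exact: center_form_trace_gt0.
Qed.

Lemma quad_form_rescale_diff_vec (R : realType) (n : nat) (m : 'cV[R]_n)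
    (A : 'M[R]_n) i j :
  quad_form (rescale m A).2 (diff_vec i j) =
  Num.sqrt (n%:R / \tr (center_form A)) ^+ 2 * quad_form A (diff_vec i j).
Proof.
by rewrite /= quad_formZl quad_form_center centering_id// sum_diff_vec.
Qed.

Lemma rescale_normalized (R : realType) (n : nat) (m : 'cV[R]_n) (A : 'M[R]_n) :
  (1 < n)%N -> A^T = A -> \sum_k m k 0 = 0 -> pos_on_centered A ->
  normalized (rescale m A).1 (rescale m A).2.
Proof.
move=> n1 Asym m0 Apos; have n0 := ltnW n1.
have c0 := rescale_factor_gt0 n1 Apos.
have t0 := center_form_trace_gt0 n1 Apos.
rewrite /rescale/=; set c := Num.sqrt _ in c0 *.
have c2 : c ^+ 2 = n%:R / \tr (center_form A).
  by rewrite sqr_sqrtr// divr_ge0// ltW.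
split; [|split; [|split; [|split; [|split]]]].
- by rewrite linearZ/= /center_form !trmx_mul trmx_centering Asym mulmxA.
- move=> x; rewrite -/(quad_form _ x) quad_formZl mulr_ge0 ?sqr_ge0//.
  rewrite quad_form_center; have [->|Hx] := eqVneq (centering n *m x) 0.
    by rewrite /quad_form mulmx0 mxE.
  by apply/ltW/Apos => //; exact: sum_centering.
- by under eq_bigr do rewrite mxE; rewrite -mulr_sumr m0 mulr0.
- by rewrite -scalemxAl /center_form -mulmxA centering_const1// mulmx0 scaler0.
- by rewrite mxtraceZ c2 divfK// gt_eqF.
- by rewrite mxrank_scale_nz ?center_form_rank// expf_neq0// gt_eqF.
Qed.

Lemma prob_ge_rescale (R : realType) (n : nat) (m : 'cV[R]_n) (A : 'M[R]_n) i j :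
  (1 < n)%N -> pos_on_centered A ->
  prob_ge (rescale m A).1 (rescale m A).2 i j = prob_ge m A i j.
Proof.
move=> n1 Apos; rewrite !prob_geE quad_form_rescale_diff_vec !mxE -mulrBr.
rewrite gauss1_ge0_scale ?rescale_factor_gt0//.
have [->|ij] := eqVneq i j.
  by rewrite quad_form_diff_vec subrr sub0r addrC subrr.
by apply/ltW/Apos; [exact: sum_diff_vec|exact: diff_vec_neq0].
Qed.

(** * Perturbations preserving pairwise choices *)

(** The factor [r] may depend on the pair; this freedom is what allows models that are not mere
    rescalings. *)
Definition same_choices {R : realType} {n : nat} (mu : 'cV[R]_n) (S : 'M[R]_n)
    (m : 'cV[R]_n) (A : 'M[R]_n) : Prop :=
  forall k l, exists2 r : R, 0 < r &
    m k 0 - m l 0 = r * (mu k 0 - mu l 0) /\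
    quad_form A (diff_vec k l) = r ^+ 2 * quad_form S (diff_vec k l).

Lemma same_choices_prob_ge (R : realType) (n : nat) (mu m : 'cV[R]_n)
    (S A : 'M[R]_n) k l : psd S -> same_choices mu S m A ->
  prob_ge m A k l = prob_ge mu S k l.
Proof.
move=> [_ S0] /(_ k l)[r r0 [mr vr]].
by rewrite !prob_geE mr vr gauss1_ge0_scale.
Qed.

Lemma normalized_psd (R : realType) (n : nat) (mu : 'cV[R]_n) (S : 'M[R]_n) :
  normalized mu S -> psd S.
Proof. by case=> Ssym [S0 _]. Qed.

(** Positivity is stable: if [d] is the coercivity constant, entries of size at most [d / 2 / n]
    change the form by at most half of its lower bound, by [quad_form_bound]. *)
Lemma normalized_pos_on_centered (R : realType) (n : nat) (mu : 'cV[R]_n)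
    (S : 'M[R]_n) : (0 < n)%N -> normalized mu S ->
  exists2 d : R, 0 < d & forall P : 'M[R]_n,
    (forall k l, `|P k l| <= d) -> pos_on_centered (S + P).
Proof.
move=> n0 hn; have [_ [_ [_ [S1 [_ rkS]]]]] := hn.
have [d d0 Sd] := psd_coercive n0 (normalized_psd hn) S1 rkS.
have nR0 : 0 < n%:R :> R by rewrite ltr0n.
exists (d / 2 / n%:R); first by rewrite !divr_gt0.
move=> P Pd x x0 xn0; rewrite quad_formDl.
have := quad_form_bound x Pd; rewrite divfK ?gt_eqF//.
have q0 : 0 < \sum_k x k 0 ^+ 2.
  rewrite lt_def sumr_ge0 ?andbT => [|k _]; last exact: sqr_ge0.
  apply: contra_neq xn0 => /eqP; rewrite psumr_eq0 => [/allP q0|k _]; last exact: sqr_ge0.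
  by apply/colP => k; apply/eqP; have := q0 k (mem_index_enum _); rewrite sqrf_eq0 mxE.
have := Sd x x0; move: (\sum_k _) q0 => q q0 Sq.
rewrite ler_norml => /andP[Pq _]; have := mulr_gt0 d0 q0; lra.
Qed.

(* A pair [a != b] whose variance is left untouched reads off the rescaling
   factor, so that distinct parameters give distinct rescaled models. *)
Lemma infinite_rescaled_family (R : realType) (n : nat) (mu : 'cV[R]_n)
    (S : 'M[R]_n) (m : R -> 'cV[R]_n) (P : R -> 'M[R]_n) (C : R) (a b : 'I_n) :
  (1 < n)%N -> normalized mu S ->
  (forall t, (P t)^T = P t) ->
  (forall t, \sum_k m t k 0 = 0) ->
  (forall t k l, 0 < t <= 1 -> `|P t k l| <= C * t) ->
  (forall t, 0 < t <= 1 -> pos_on_centered (S + P t) ->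
     same_choices mu S (m t) (S + P t)) ->
  a != b ->
  (forall t, quad_form (P t) (diff_vec a b) = 0) ->
  (forall s t, m s = m t ->
     (forall k l, quad_form (P s) (diff_vec k l) = quad_form (P t) (diff_vec k l)) ->
     s = t) ->
  exists SS : set ('cV[R]_n * 'M[R]_n),
    infinite_set SS /\
    forall p, SS p ->
      normalized p.1 p.2 /\
      forall i j : 'I_n, prob_ge mu S i j = prob_ge p.1 p.2 i j.
Proof.
move=> n1 hn Psym m0 PC Psame ab Pab Pinj; have n0 := ltnW n1.
have [d d0 Sd] := normalized_pos_on_centered n0 hn.
have [K K0 CK] : exists2 K : R, 0 < K & C <= K.
  by exists (`|C| + 1); [rewrite ltr_wpDl | rewrite ler_wpDr// ler_norm].
(* The bound 1 keeps [t] where the hypotheses on [P] apply; the bound [d / K] keeps the entries of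
   [P t] at most [d], so that positivity survives. *)
pose e := Num.min 1 (d / K).
have e0 : 0 < e by rewrite lt_min ltr01 divr_gt0.
pose T (t : R) := 0 < t <= e.
have T01 t : T t -> 0 < t <= 1.
  by move=> /andP[-> te] /=; rewrite (le_trans te)// ge_min lexx.
have Tpos t : T t -> pos_on_centered (S + P t).
  move=> Tt; apply: Sd => k l; apply: le_trans (PC t k l (T01 _ Tt)) _.
  case/andP: Tt => t0 te; apply: le_trans (_ : K * t <= _); first by rewrite ler_pM2r.
  by rewrite mulrC -ler_pdivlMr// (le_trans te)// ge_min lexx orbT.
pose f t := rescale (m t) (S + P t).
have finj s t : T s -> T t -> f s = f t -> s = t.
  move=> Ts Tt fE; have cs := rescale_factor_gt0 n1 (Tpos _ Ts).
  have ct := rescale_factor_gt0 n1 (Tpos _ Tt).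
  have Q k l : quad_form (f s).2 (diff_vec k l) = quad_form (f t).2 (diff_vec k l).
    by rewrite fE.
  have Eab : 0 < quad_form S (diff_vec a b).
    have := Tpos t Tt _ (sum_diff_vec R a b) (diff_vec_neq0 R ab).
    by rewrite quad_formDl Pab addr0.
  have cst : Num.sqrt (n%:R / \tr (center_form (S + P s))) =
      Num.sqrt (n%:R / \tr (center_form (S + P t))).
    apply/eqP; rewrite -(eqrXn2 (n := 2)) ?ltW//; apply/eqP.
    have := Q a b; rewrite !quad_form_rescale_diff_vec !quad_formDl !Pab addr0.
    by apply: mulIf; rewrite gt_eqF.
  (* With equal factors, cancellation leaves equal means and equal variance increments. *)
  apply: Pinj => [|k l].
    have /(congr1 fst) := fE; rewrite /f /rescale/= cst => /scalerI; apply.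
    by rewrite gt_eqF.
  have := Q k l; rewrite !quad_form_rescale_diff_vec !quad_formDl cst.
  by move/mulfI => h; apply: addrI (h _); rewrite expf_neq0// gt_eqF.
pose g (k : nat) := e / k.+1%:R.
have gT k : T (g k).
  rewrite /T /g divr_gt0 ?ltr0n//= ler_pdivrMr ?ltr0n// ler_peMr ?ler1n//.
  exact: ltW.
exists (range (f \o g)); split.
  suff fgI : {in [set: nat] &, injective (f \o g)}.
    by rewrite (eq_finite_set (inj_card_eq fgI)); exact: infinite_nat.
  move=> k l _ _ /= /(finj _ _ (gT k) (gT l)) /(mulfI (lt0r_neq0 e0)) /invr_inj.
  by move=> /eqP; rewrite eqr_nat eqSS => /eqP.
move=> _ [k _ <-] /=; split.
  apply: rescale_normalized => //; last exact: Tpos.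
  by rewrite linearD/= Psym; case: hn => ->.
move=> i j; apply/esym.
apply: etrans (prob_ge_rescale (m (g k)) i j n1 (Tpos _ (gT k))) _.
apply: same_choices_prob_ge; first exact: normalized_psd hn.
by apply: Psame; [exact: T01|exact: Tpos].
Qed.

(** * The two constructions: a tie in the means, and distinct means *)

Lemma third_index (n : nat) (i j : 'I_n) : (3 <= n)%N ->
  exists l : 'I_n, l \notin [:: i; j].
Proof.
move=> n3; apply/existsP; apply: contraLR n3 => /existsPn ijn.
rewrite -leqNgt -[n in (n <= _)%N]card_ord; apply: leq_trans (card_size [:: i; j]).
by apply/subset_leq_card/fintype.subsetP => x _; have /negPn := ijn x.
Qed.

(** Changing only the covariance of [X_i] and [X_j] alters the variance of [X_i - X_j] and of no
    other difference. As this difference has mean zero, any positive variance gives the same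
    probability. *)
Lemma infinite_equivalent_of_tie (R : realType) (n : nat) (mu : 'cV[R]_n) (S : 'M[R]_n)
    (i j : 'I_n) : (3 <= n)%N -> normalized mu S -> i != j -> mu i 0 = mu j 0 ->
  exists SS : set ('cV[R]_n * 'M[R]_n),
    infinite_set SS /\
    forall p, SS p ->
      normalized p.1 p.2 /\
      forall i j : 'I_n, prob_ge mu S i j = prob_ge p.1 p.2 i j.
Proof.
move=> n3 hn ij muij; have n1 : (1 < n)%N := ltnW n3; have n0 := ltnW n1.
have [l] := third_index i j n3; rewrite !inE negb_or => /andP[li lj].
have [d d0 Sd] := normalized_pos_on_centered n0 hn.
have Spos : pos_on_centered S.
  by rewrite -[S]addr0; apply: Sd => k k'; rewrite mxE normr0 ltW.
pose P (t : R) : 'M[R]_n := t *: (delta_mx i j + delta_mx j i).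
have Pq t k k' : quad_form (P t) (diff_vec k k') =
    t * (2 * ((i == k)%:R - (i == k')%:R) * ((j == k)%:R - (j == k')%:R)).
  rewrite quad_formZl quad_form_diff_vec !mxE; congr (_ * _).
  rewrite !(eq_sym i) !(eq_sym j).
  by case: (k == i); case: (k == j); case: (k' == i); case: (k' == j) => /=; ring.
apply: (@infinite_rescaled_family R n mu S (fun=> mu) P 2 i l) => //.
- by move=> t; rewrite /P linearZ/= linearD/= !trmx_delta addrC.
- by move=> _; case: hn => _ [_ [->]].
- move=> t k k' /andP[t0 _]; rewrite !mxE normrM (gtr0_norm t0) mulrC ler_pM2r//.
  apply: le_trans (ler_normD _ _) _; rewrite !normr_nat.
  by rewrite -natrD ler_nat; case: (_ && _); case: (_ && _).
- move=> t t01 Apos k k'; have [->|kk'] := eqVneq k k'.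
    exists 1 => //; rewrite !subrr !quad_form_diff_vec; split; ring.
  have Vp := Apos _ (sum_diff_vec R k k') (diff_vec_neq0 R kk').
  have Vp0 := Spos _ (sum_diff_vec R k k') (diff_vec_neq0 R kk').
  have [mukk'|mukk'] := eqVneq (mu k 0) (mu k' 0).
    (* The means impose nothing on a tied pair, so the factor is read off the variances alone. *)
    exists (Num.sqrt (quad_form (S + P t) (diff_vec k k') /
                      quad_form S (diff_vec k k'))).
      by rewrite sqrtr_gt0 divr_gt0.
    rewrite mukk' subrr mulr0; split => //.
    by rewrite sqr_sqrtr ?divfK ?gt_eqF// ltW// divr_gt0.
  exists 1 => //; rewrite mul1r; split => //.
  rewrite expr1n mul1r quad_formDl Pq.
  (* The increment is nonzero only for the pair of [i] and [j], which is excluded here since [mu k]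
     and [mu k'] differ. *)
  have [ik|ik] := eqVneq i k; have [jk|jk] := eqVneq j k;
    have [ik'|ik'] := eqVneq i k'; have [jk'|jk'] := eqVneq j k';
    subst; rewrite ?eqxx// ?muij ?eqxx// in ij kk' mukk' *; try ring.
- by rewrite eq_sym.
- move=> t; rewrite Pq (eq_sym j i) (negbTE ij) (eq_sym j l) (negbTE lj); ring.
- move=> s t _ /(_ i j); rewrite !Pq !eqxx (eq_sym j i) (negbTE ij).
  move/mulIf; apply.
  by rewrite /= !(mulr1n, mulr0n) subr0 sub0r mulr1 mulrN1 oppr_eq0 pnatr_eq0.
Qed.

(* If [mu] is injective, the largest coordinate [mu i] can be moved up by [t]
   provided that each variance of [X_i - X_l] is multiplied by
   [(1 + t / (mu i - mu l))^2]. *)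
Lemma infinite_equivalent_of_injective (R : realType) (n : nat) (mu : 'cV[R]_n) (S : 'M[R]_n) :
  (3 <= n)%N -> normalized mu S -> injective (mu^~ 0) ->
  exists SS : set ('cV[R]_n * 'M[R]_n),
    infinite_set SS /\
    forall p, SS p ->
      normalized p.1 p.2 /\
      forall i j : 'I_n, prob_ge mu S i j = prob_ge p.1 p.2 i j.
Proof.
move=> n3 hn muI; have n1 : (1 < n)%N := ltnW n3; have n0 := ltnW n1.
have [i imax] : exists i, forall l, l != i -> mu l 0 < mu i 0.
  case: (@Order.TotalTheory.arg_maxP _ _ _ (Ordinal n0) xpredT (mu^~ 0)) => // i _ h.
  by exists i => l li; rewrite lt_neqAle [X in _ && X]h// andbT; apply: contra li => /eqP/muI ->.
(* Since [n] is at least 3, there are two distinct indices other than [i]; their difference keeps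
   its variance. *)
have [a] := third_index i i n3; rewrite !inE orbb => ai.
have [b] := third_index i a n3; rewrite !inE negb_or => /andP[bi ba].
pose V l := quad_form S (diff_vec i l).
have Vii : V i = 0 by rewrite /V quad_form_diff_vec; ring.
pose D l := mu i 0 - mu l 0.
(* [w t i = 0] because [V i = 0]. *)
pose w t l := V l * ((1 + t / D l) ^+ 2 - 1).
have wi t : w t i = 0 by rewrite /w Vii mul0r.
(* Only row and column [i] are perturbed, so that the variance of [X_i - X_l] grows by [w t l] and
   differences not involving [i] are unchanged. *)
pose P t : 'M[R]_n :=
  \matrix_(k, l) (- ((k == i)%:R * w t l + (l == i)%:R * w t k) / 2).
have Pq t k l : quad_form (P t) (diff_vec k l) =
    ((k == i)%:R - (l == i)%:R) * (w t l - w t k).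
  by rewrite quad_form_diff_vec !mxE; field.
pose m t : 'cV[R]_n := centering n *m (mu + t *: delta_mx i 0).
have mB t k l : m t k 0 - m t l 0 =
    mu k 0 - mu l 0 + t * ((k == i)%:R - (l == i)%:R).
  by rewrite /m !centeringE !mxE !andbT; ring.
(* With [u = 1 / D l], [(1 + t * u)^2 - 1 = (2 * u + u^2 * t) * t], and [t <= 1] bounds the first
   factor. *)
pose K l := `|V l| * (2 * `|(D l)^-1| + `|(D l)^-1| ^+ 2).
have K0 l : 0 <= K l by rewrite mulr_ge0// addr_ge0 ?mulr_ge0// exprn_ge0.
have wK t l : 0 < t <= 1 -> `|w t l| <= K l * t.
  move=> /andP[t0 t1]; rewrite /w /K normrM -mulrA ler_wpM2l//.
  set u := (D l)^-1.
  rewrite (_ : _ - 1 = (2 * u + u ^+ 2 * t) * t); last by ring.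
  rewrite normrM (gtr0_norm t0) ler_pM2r//.
  apply: le_trans (ler_normD _ _) _; rewrite 2!normrM normrX (gtr0_norm t0) normr_nat.
  by rewrite lerD2l ler_piMr// exprn_ge0.
have KC l : K l <= \sum_l K l.
  by rewrite [leRHS](bigD1 l)//= lerDl sumr_ge0.
apply: (@infinite_rescaled_family R n mu S m P (\sum_l K l) a b) => //.
- by move=> t; apply/matrixP => k l; rewrite !mxE addrC.
- by move=> t; exact: sum_centering.
- move=> t k l t01; have t0 := andP t01.
  have wC l' : `|w t l'| <= (\sum_l K l) * t.
    by apply: le_trans (wK t l' t01) _; rewrite ler_pM2r//; case: t0.
  rewrite mxE normrM normrN (ger0_norm (_ : 0 <= 2^-1)) ?invr_ge0//.
  rewrite ler_pdivrMr// mulr_natr mulr2n.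
  apply: le_trans (ler_normD _ _) (lerD _ _); rewrite normrM normr_nat.
    by apply: le_trans (wC l); rewrite ler_piMl//; case: (_ == _).
  by apply: le_trans (wC k); rewrite ler_piMl//; case: (_ == _).
- move=> t /andP[t0 _] _ k l.
  (* Maximality of [mu i] makes [D x] positive, so the factor is positive for every [t > 0]. *)
  have rpos x : x != i -> 0 < 1 + t / D x.
    by move=> xi; rewrite addr_gt0// divr_gt0// subr_gt0 imax.
  have Dn0 x : x != i -> D x != 0 by move=> xi; rewrite gt_eqF// subr_gt0 imax.
  rewrite mB quad_formDl Pq.
  have [->|ki] := eqVneq k i; have [->|li] := eqVneq l i;
    rewrite /= ?(mulr1n, mulr0n).
  + by exists 1 => //; rewrite !subrr; split; ring.
  + exists (1 + t / D l); first exact: rpos.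
    rewrite wi -/(V l) -/(D l) /w; split; last by ring.
    by field; exact: Dn0.
  + exists (1 + t / D k); first exact: rpos.
    have -> : quad_form S (diff_vec k i) = V k.
      by rewrite /V !quad_form_diff_vec; ring.
    rewrite wi /w; split; last by ring.
    rewrite -(opprB (mu i 0)) -/(D k).
    by field; exact: Dn0.
  + by exists 1 => //; split; ring.
- by rewrite eq_sym.
- by move=> t; rewrite Pq (negbTE ai) (negbTE bi) subrr mul0r.
(* The gap between the means of [i] and [a] is [D a + t], which determines [t]. *)
- move=> s t mst _; have := mB s i a; rewrite mst mB eqxx (negbTE ai) /=.
  rewrite mulr1n mulr0n; lra.
Qed.

Theorem theorem1 (R : realType) (n : nat) (hn : (3 <= n)%N)
  (mu : 'cV[R]_n) (S : 'M[R]_n) (hnorm : normalized mu S) :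
  exists SS : set ('cV[R]_n * 'M[R]_n),
    infinite_set SS /\
    forall p, SS p ->
      normalized p.1 p.2 /\
      forall i j : 'I_n, prob_ge mu S i j = prob_ge p.1 p.2 i j.
Proof.
have [[i [j [ij muij]]]|notie] :=
    pselect (exists i j : 'I_n, i != j /\ mu i 0 = mu j 0).
  exact: infinite_equivalent_of_tie ij muij.
apply: infinite_equivalent_of_injective => // i j muij; apply/eqP/negPn/negP => ij.
by apply: notie; exists i, j.
Qed.
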